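(* The category $\mathcal{S}'$ of compactly flowing streams and stream maps between them is Cartesian closed.
   Context: A preorder is a reflexive and transitive relation. For a relation $R$ on a set $X$, $\mathrm{graph}(R)=\{(x,y)\in X\times X : x\,R\,y\}$. For a family $\{(A_i,\leqslant_{i})\}_{i}$ of preordered sets, $\bigvee_{i}\leqslant_{i}$ denotes the preorder on $\bigcup_i A_i$ that is the transitive-reflexive closure of the relation with graph $\bigcup_{i}\mathrm{graph}(\leqslant_{i})$. A circulation $\leqslant$ on a space $X$ is a function assigning to each open subset $U\subset X$ a preorder $\leqslant_U$ on $U$ such that $\leqslant_{\bigcup\mathcal{O}}=\bigvee_{U\in\mathcal{O}}\leqslant_U$ for each collection $\mathcal{O}$ of open subsets of $X$. A stream $(X,\leqslant)$ is a space $X$ with a circulation on it. A stream map $f:(X,\leqslant)\to(Y,\leqslant')$ is a continuous function $f:X\to Y$ such that, for all open $U\subset Y$, $f(x)\leqslant'_U f(y)$ whenever $x\leqslant_{f^{-1}U}y$. A precirculation $\leqslant$ on $X$ assigns to each open $U\subset X$ a preorder $\leqslant_U$ on $U$ with $\mathrm{graph}(\leqslant_U)\subset\mathrm{graph}(\leqslant_V)$ whenever $U\subset V$ (every circulation is one). For a continuous $f:X\to Y$ and a precirculation $\leqslant$ on $Y$, the pullback $\leqslant^{f^*}$ is the precirculation on $X$ with $\mathrm{graph}(\leqslant^{f^*}_U)=(U\times U)\cap\bigcap_{V}(f\times f)^{-1}(\mathrm{graph}(\leqslant_V))$, the intersection over all open $V\subset Y$ with $f(U)\subset V$. The cosheafification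 $\leqslant^!$ of a precirculation $\leqslant$ on $X$ is the circulation with $\leqslant^!_U=\bigvee\leqslant'_U$, the join over all circulations $\leqslant'$ on $X$ such that $\mathrm{graph}(\leqslant'_W)\subset\mathrm{graph}(\leqslant_W)$ for all open $W\subset X$. For a stream $(X,\leqslant)$ and a subspace $A\subset X$, the substream on $A$ is $(A,(\leqslant^{(A\hookrightarrow X)^*})^!)$, and $\leqslant_{\restriction A}$ denotes the preorder $(\leqslant^{(A\hookrightarrow X)^*})^!_A$ on $A$. A space $X$ is weak Hausdorff if images in $X$ of continuous functions from compact Hausdorff spaces are closed; $X$ is compactly generated if it is weak Hausdorff and a subset $U\subset X$ is open whenever $U\cap K$ is open in $K$ for all compact Hausdorff subspaces $K\subset X$. For a weak Hausdorff space $X$, let $\mathcal{K}(X)$ be the family of compact Hausdorff subsets of $X$. A circulation $\leqslant$ on $X$ is a k-circulation if $\leqslant_U=\bigvee_{L\in\mathcal{K}(U)}\leqslant_{\restriction L}$ for all open $U\subset X$. A stream $(X,\leqslant)$ is compactly flowing if $X$ is compactly generated and $\leqslant$ is a k-circulation. *)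

(* Defs.v *)
From Stdlib Require Relation_Operators.
From HB Require Import structures.
From mathcomp Require Import all_boot all_order all_algebra.
From mathcomp Require Import all_classical all_reals all_analysis.

Set Implicit Arguments.
Unset Strict Implicit.
Unset Printing Implicit Defensive.

Local Open Scope classical_set_scope.

Record category := Category {
  Ob :> Type;
  Hom : Ob -> Ob -> Type;
  idmap : forall A, Hom A A;
  comp : forall A B C, Hom B C -> Hom A B -> Hom A C;
  comp_idl : forall A B (f : Hom A B), comp (idmap B) f = f;
  comp_idr : forall A B (f : Hom A B), comp f (idmap A) = f;
  compA : forall A B C D (h : Hom C D) (g : Hom B C) (f : Hom A B),
    comp h (comp g f) = comp (comp h g) f }.

Arguments idmap {c} A.
Arguments comp {c A B C} _ _.

Definition full_subcategory (C : category) (P : C -> Prop) : category :=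
  @Category {A : C | P A} (fun A B => Hom (sval A) (sval B))
    (fun A => idmap (sval A))
    (fun A B D => @comp C (sval A) (sval B) (sval D))
    (fun A B => @comp_idl C (sval A) (sval B))
    (fun A B => @comp_idr C (sval A) (sval B))
    (fun A B D E => @compA C (sval A) (sval B) (sval D) (sval E)).

Section CartesianClosed.
Variable C : category.

Definition is_terminal (T : C) : Prop := forall X : C, exists! _ : Hom X T, True.

Definition is_product (A B P : C) (p : Hom P A) (q : Hom P B) : Prop :=
  forall (X : C) (f : Hom X A) (g : Hom X B),
    exists! h : Hom X P, comp p h = f /\ comp q h = g.

(* The map [k] below is [h * id_A : X * A -> E * A]. *)
Definition is_exponential (A B E P : C) (p : Hom P E) (q : Hom P A)
    (ev : Hom P B) : Prop :=
  forall (X Q : C) (p' : Hom Q X) (q' : Hom Q A), is_product p' q' ->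
  forall g : Hom Q B, exists! h : Hom X E,
    exists k : Hom Q P, [/\ comp p k = comp h p', comp q k = q' & comp ev k = g].

Definition cartesian_closed : Prop :=
  [/\ exists T : C, is_terminal T,
      forall A B : C,
        exists (P : C) (p : Hom P A) (q : Hom P B), is_product p q
    & forall A B : C,
        exists (E P : C) (p : Hom P E) (q : Hom P A) (ev : Hom P B),
          is_product p q /\ is_exponential p q ev].

End CartesianClosed.

(* A preorder on [A : set T] is a relation on [T] whose graph lies in
   [A `*` A]. *)
Definition preorder_on (T : Type) (A : set T) (R : T -> T -> Prop) : Prop :=
  [/\ forall x y, R x y -> A x /\ A y,
      forall x, A x -> R x x
    & forall x y z, R x y -> R y z -> R x z].

(* [clos_refl_trans] is reflexive on all of [T], hence the membership
   conditions in the union of the carriers. *)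
Definition preorder_join (T I : Type) (D : set I) (A : I -> set T)
    (R : I -> T -> T -> Prop) (x y : T) : Prop :=
  [/\ (\bigcup_(i in D) A i) x, (\bigcup_(i in D) A i) y
    & Relation_Operators.clos_refl_trans T
        (fun a b => exists2 i, D i & R i a b) x y].

(* A (pre)circulation is a function on all of [set X], of which only the values
   on the open sets matter; no condition is put on the other ones and no
   definition looks at them. *)
Section Circulations.
Implicit Types X Y : topologicalType.

Definition is_circulation X (c : set X -> X -> X -> Prop) : Prop :=
  (forall U, open U -> preorder_on U (c U)) /\
  (forall O : set (set X), O `<=` open -> forall x y,
     c (\bigcup_(U in O) U) x y <-> preorder_join O id c x y).

Definition pullback X Y (f : X -> Y) (c : set Y -> Y -> Y -> Prop)
    (U : set X) (x y : X) : Prop :=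
  [/\ U x, U y & forall V : set Y, open V -> f @` U `<=` V -> c V (f x) (f y)].

Definition cosheafification X (c : set X -> X -> X -> Prop) (U : set X) :
    X -> X -> Prop :=
  preorder_join
    [set d : set X -> X -> X -> Prop | is_circulation d /\
       forall W, open W -> forall x y, d W x y -> c W x y]
    (fun=> U) (fun d => d U).

Definition substream_circulation X (c : set X -> X -> X -> Prop) (A : set X) :
    set (set_type A) -> set_type A -> set_type A -> Prop :=
  cosheafification (pullback (@set_val X A) c).

Definition restr_preorder X (c : set X -> X -> X -> Prop) (A : set X)
    (x y : X) : Prop :=
  exists a b : set_type A, [/\ set_val a = x, set_val b = y
    & substream_circulation c [set: set_type A] a b].

Definition compact_hausdorff X : Prop :=
  compact [set: X] /\ hausdorff_space X.

Definition weak_hausdorff X : Prop :=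
  forall K : topologicalType, compact_hausdorff K ->
  forall f : K -> X, continuous f -> closed (range f).

Definition compactly_generated X : Prop :=
  weak_hausdorff X /\
  forall U : set X,
    (forall K : set X, compact_hausdorff (set_type K) ->
       open (@set_val X K @^-1` U)) ->
    open U.

Definition is_k_circulation X (c : set X -> X -> X -> Prop) : Prop :=
  forall U, open U -> forall x y, c U x y <->
    preorder_join [set L : set X | L `<=` U /\ compact_hausdorff (set_type L)]
      id (restr_preorder c) x y.

End Circulations.

Record stream := Stream {
  space :> topologicalType;
  circ : set space -> space -> space -> Prop;
  circP : is_circulation circ }.

Record stream_map (X Y : stream) := StreamMap {
  smap :> X -> Y;
  smap_continuous : continuous smap;
  smapP : forall U : set Y, open U -> forall x y,
    circ (smap @^-1` U) x y -> circ U (smap x) (smap y) }.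

Lemma stream_map_eq (X Y : stream) (f g : stream_map X Y) :
  smap f = smap g -> f = g.
Proof.
case: f g => f fc fP [g gc gP] /= fg; case: _ / fg gc gP => gc gP.
by congr StreamMap; exact: Prop_irrelevance.
Qed.

Definition stream_id (X : stream) : stream_map X X.
Proof. by exists id => // x; exact: cvg_id. Defined.

Definition stream_comp (X Y Z : stream) (g : stream_map Y Z)
  (f : stream_map X Y) : stream_map X Z.
Proof.
exists (g \o f).
  by move=> x; apply: continuous_comp; exact: smap_continuous.
move=> U oU x y fgxy; apply: (smapP oU); apply: smapP fgxy.
by apply: open_comp => // z _; exact: smap_continuous.
Defined.

Definition stream_category : category.
Proof.
by refine (@Category stream stream_map stream_id stream_comp _ _ _);
  move=> *; exact: stream_map_eq.
Defined.

Definition compactly_flowing (X : stream) : Prop :=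
  compactly_generated X /\ is_k_circulation (@circ X).

Definition compactly_flowing_category : category :=
  @full_subcategory stream_category compactly_flowing.

(* Main.v *)
From HB Require Import structures.
From Stdlib Require Import Relation_Operators.
From mathcomp Require Import all_boot all_classical all_analysis.
Require Import Defs.

(** Why the category is Cartesian closed.

    Circulations can be generated: for any family of continuous maps from
    streams to a space X there is a least circulation on X making all of them
    stream maps, two points being related on U when they are joined by a finite
    chain of images of related points ([generated]). A continuous map out of
    such a stream is a stream map as soon as its composites with the generators
    are ([monotone_flow_generated]). If the generators come from compactly
    flowing streams and X is weak Hausdorff, the generated circulation is a
    k-circulation ([generated_k_circulation]), since a compact Hausdorff subset
    of a source is carried to a compact Hausdorff subset of X, and the
    substreams follow.

    The key observation is that the circulation of a product is generated by
    its slices X * {y} and {x} * Y. A path of the flow in a product can be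
    replaced locally by a horizontal move followed by a vertical one: if l flows
    to l' inside N, and N * N is mapped into the open set W by
    (k, k') |-> (first coordinate of k, second coordinate of k'), then both
    moves stay in W. The existence of
    such N uses that the source is compact Hausdorff, so that continuity can be
    tested on its square ([prod_pair_monotone_flow]). Hence a continuous map
    on a product is a stream map if and only if it is one in each variable
    separately.

    For this reason the exponential of B by A can be taken to be the set of
    stream maps from A to B, with the circulation generated by all continuous
    h : Z -> B^A, Z compactly flowing, such that z |-> h z a is a stream map for
    each a. Evaluation is a stream map in the first variable by the choice of
    the generators and in the second one because the points of B^A are stream
    maps ([exp_eval_monotone_flow]); the transpose of a stream map is one of the
    generators ([curry_exists]).

    The underlying spaces are those of the usual Cartesian closed category of
    compactly generated weak Hausdorff spaces. All three (point, product,
    exponential) are built in the same way: a set with a class of maps from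
    compact Hausdorff spaces, the probes, carries the finest topology for which
    the probes are continuous ([probe_space]). *)

Set Implicit Arguments.
Unset Strict Implicit.
Unset Printing Implicit Defensive.

Local Open Scope classical_set_scope.

(** * Topological preliminaries *)

Lemma open_sub_nbhs (X : topologicalType) (W : set X) :
  (forall x, W x -> exists N, [/\ open N, N x & N `<=` W]) -> open W.
Proof.
move=> nW; rewrite openE => x /nW[N [oN Nx NW]].
by rewrite /interior nbhsE; exists N.
Qed.

Lemma open_setX (X Y : topologicalType) (A : set X) (B : set Y) :
  open A -> open B -> open (A `*` B).
Proof.
move=> oA oB; rewrite openE => -[x y] [/= Ax By].
by exists (A, B) => //=; split; exact: open_nbhs_nbhs.
Qed.

Lemma open_prod_box (X Y : topologicalType) (W : set (X * Y)) (x : X) (y : Y) :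
  open W -> W (x, y) -> exists A B,
  [/\ open A, open B, A x, B y & A `*` B `<=` W].
Proof.
rewrite openE => + Wxy => /(_ _ Wxy)[[A B]] /= [].
rewrite !nbhsE => -[A' [oA' A'x] AA'] [B' [oB' B'y] BB'] ABW.
exists A', B'; split => // -[a b] [/= A'a B'b]; apply: ABW; split => /=.
  exact: AA'.
exact: BB'.
Qed.

Lemma continuous_pair (X Y Z : topologicalType) (f : Z -> X) (g : Z -> Y) :
  continuous f -> continuous g -> continuous (fun z => (f z, g z)).
Proof. by move=> cf cg z; exact: (cvg_pair (cf z) (cg z)). Qed.

Lemma continuous_diag (X : topologicalType) : continuous (fun x : X => (x, x)).
Proof. by apply: continuous_pair => x; exact: cvg_id. Qed.

Lemma continuous_fst (X Y : topologicalType) : continuous (@fst X Y).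
Proof. by move=> [x y]; exact: cvg_fst. Qed.

Lemma continuous_snd (X Y : topologicalType) : continuous (@snd X Y).
Proof. by move=> [x y]; exact: cvg_snd. Qed.

Lemma continuous_funcomp (X Y Z : topologicalType) (g : Y -> Z) (f : X -> Y) :
  continuous g -> continuous f -> continuous (g \o f).
Proof. by move=> cg cf x; apply: continuous_comp; [exact: cf|exact: cg]. Qed.

Lemma open_preimage (X Y : topologicalType) (f : X -> Y) (U : set Y) :
  continuous f -> open U -> open (f @^-1` U).
Proof. by move=> /continuousP; apply. Qed.

Lemma closed_preimage (X Y : topologicalType) (f : X -> Y) (D : set Y) :
  continuous f -> closed D -> closed (f @^-1` D).
Proof. by move=> /continuous_closedP; apply. Qed.

Lemma disjoint_absurd (T : Type) (A B : set T) (x : T) :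
  A `&` B = set0 -> A x -> B x -> False.
Proof. by move=> AB0 Ax Bx; have : (A `&` B) x by []; rewrite AB0. Qed.

Lemma hausdorff_sep (X : topologicalType) (x y : X) :
  hausdorff_space X -> x <> y ->
  exists A B, [/\ open A, open B, A x, B y & A `&` B = set0].
Proof.
rewrite open_hausdorff => + /eqP xy => /(_ _ _ xy)[[A B]] /=.
by move=> [/set_mem Ax /set_mem By] [oA oB /eqP AB0]; exists A, B.
Qed.

(** The tube lemma. *)
Lemma compact_forall_open (X Y : topologicalType) (C : set Y)
    (W : set (X * Y)) : compact C -> open W ->
  open [set x | forall y, C y -> W (x, y)].
Proof.
move=> /compact_near_coveringP cC oW; rewrite openE => x Wx.
rewrite /interior.
apply: (cC X (nbhs x) (fun x y => W (x, y))) => y Cy.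
have [A [B [oA oB Ax By ABW]]] := open_prod_box oW (Wx _ Cy).
exists (B, A) => /=; first by split; exact: open_nbhs_nbhs.
by move=> [b a] [/= Bb Aa]; apply: ABW.
Qed.

(** The complement of a projection along X is a universal quantification
    over X, so that the tube lemma applies. *)
Lemma closed_proj2 (X Y : topologicalType) (D : set (X * Y)) :
  compact [set: X] -> closed D -> closed [set y | exists x, D (x, y)].
Proof.
move=> cX cD; rewrite -openC.
rewrite (_ : ~` _ =
    [set y | forall x, [set: X] x ->
      (~` ((fun p => (p.2, p.1)) @^-1` D)) (y, x)]).
  apply: compact_forall_open => //; rewrite openC.
  apply: closed_preimage => //.
  exact: continuous_pair (@continuous_snd _ _) (@continuous_fst _ _).
by apply/seteqP; split => y /= nD x; [move=> _ Dxy; apply: nD; exists x|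
  case: x => x Dxy; exact: (nD x I)].
Qed.

Lemma compact_hausdorff_prod (K M : topologicalType) :
  compact_hausdorff K -> compact_hausdorff M ->
  compact_hausdorff (K * M)%type.
Proof.
move=> [cK hK] [cM hM]; split; first by rewrite -setXTT; exact: compact_setX.
rewrite open_hausdorff => -[k m] [k' m'] /eqP ne.
have [kk'|/eqP kk'] := eqVneq k k'; last first.
  have [A [B [oA oB Ak Bk' AB0]]] := hausdorff_sep hK kk'.
  exists (A `*` setT, B `*` setT); first by split; exact/mem_set.
  split; do ?[by apply: open_setX => //; exact: openT].
  by apply/eqP/disjoints_subset => -[a b] [/= Aa _] [/= Ba _];
    exact: disjoint_absurd AB0 Aa Ba.
have mm' : m <> m' by move=> mm'; apply: ne; rewrite kk' mm'.
have [A [B [oA oB Ak Bk' AB0]]] := hausdorff_sep hM mm'.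
exists (setT `*` A, setT `*` B); first by split; exact/mem_set.
split; do ?[by apply: open_setX => //; exact: openT].
by apply/eqP/disjoints_subset => -[a b] [/= _ Aa] [/= _ Ba];
  exact: disjoint_absurd AB0 Aa Ba.
Qed.

Lemma continuous_set_val (X : topologicalType) (A : set X) :
  continuous (@set_val X A).
Proof. exact: initial_continuous. Qed.

Lemma continuous_to_set_type (X Z : topologicalType) (A : set X)
    (f : Z -> set_type A) : continuous (set_val \o f) -> continuous f.
Proof.
by move=> /continuousP cf; apply/continuousP => _ [W oW <-]; exact: cf.
Qed.

Lemma corestrict (X Z : Type) (A : set X) (f : Z -> X) :
  (forall z, A (f z)) -> exists f' : Z -> set_type A, f = set_val \o f'.
Proof. by move=> Af; exists (fun z => SigSub (mem_set (Af z))). Qed.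

(** A filter on the subtype is pushed to X; a cluster point found in A is a
    cluster point in the subtype because its topology is the initial one. *)
Lemma compact_set_type (X : topologicalType) (A : set X) :
  compact A -> compact [set: set_type A].
Proof.
move=> cA F PF _.
have [|p [Ap clp]] := cA (@set_val X A @ F) _.
  rewrite nbhs_simpl /=; apply: filterS filterT => a _; exact: set_valP.
exists (SigSub (mem_set Ap)); split => // B N FB.
rewrite nbhsE => -[_ [[W oW <-] /= Wp] WN].
have [] := clp (@set_val X A @` B) W.
- by rewrite nbhs_simpl /=; apply: filterS FB => b Bb; exists b.
- exact: open_nbhs_nbhs.
- by move=> _ [[b Bb <-] Wb]; exists b; split => //; exact: WN.
Qed.

Lemma hausdorff_set_type (X : topologicalType) (A : set X) :
  (forall x y, A x -> A y -> x <> y -> exists U V : set X,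
    [/\ open U, open V, U x, V y & forall z, A z -> U z -> V z -> False]) ->
  hausdorff_space (set_type A).
Proof.
move=> sepA; rewrite open_hausdorff => x y /eqP xy.
have [|U [V [oU oV Ux Vy UV]]] :=
    sepA (set_val x) (set_val y) (set_valP x) (set_valP y).
  by move=> /val_inj.
exists (set_val @^-1` U, set_val @^-1` V); first by split; exact/mem_set.
split; [by exists U|by exists V|].
apply/eqP/disjoints_subset => z Uz Vz; exact: (UV _ (set_valP z) Uz Vz).
Qed.

(** * Weak Hausdorff and compactly generated spaces *)

Section WeakHausdorff.
Variables (X : topologicalType) (whX : weak_hausdorff X).
Variables (K : topologicalType) (chK : compact_hausdorff K).
Variables (t : K -> X) (ct : continuous t).

(** A closed subset C of K is itself a compact Hausdorff space, to which weak
    Hausdorffness applies. *)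
Lemma weak_hausdorff_closed_image (C : set K) : closed C -> closed (t @` C).
Proof.
move=> cC; have [cK hK] := chK.
rewrite (_ : t @` C = range (t \o @set_val K C)).
  apply: whX; last exact: (continuous_funcomp ct (@continuous_set_val _ _)).
  split.
    by apply: compact_set_type; exact: (subclosed_compact cC cK).
  apply: hausdorff_set_type => x y _ _ /(hausdorff_sep hK)[U [V [? ? ? ? UV]]].
  exists U, V; split => // z _ Uz Vz; exact: disjoint_absurd UV Uz Vz.
apply/seteqP; split => x /=.
  by move=> [k Ck <-]; exists (SigSub (mem_set Ck)).
by move=> [k _ <-]; exists (set_val k) => //; exact: set_valP.
Qed.

(** The image of t is Hausdorff, in a form which keeps the separating sets open
    in X and not only in the image. The fibres of t k and t k' are disjoint
    closed sets of the normal space K; the complements of the images of the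
    complements of separating neighbourhoods separate the two points. *)
Lemma weak_hausdorff_sep (k k' : K) : t k <> t k' -> exists U V : set X,
  [/\ open U, open V, U (t k), V (t k')
    & forall z, range t z -> U z -> V z -> False].
Proof.
move=> ne; have [cK hK] := chK.
have cpt (l : K) : closed [set t l].
  rewrite (_ : [set _] = t @` [set l]); last by rewrite image_set1.
  exact/weak_hausdorff_closed_image/accessible_closed_set1/hausdorff_accessible.
have cfib (l : K) : closed (t @^-1` [set t l]) by exact: closed_preimage.
have [|C /set_nbhsP[U [oU kU UC]] CB] :=
    compact_normal hK cK (cfib k) (t := ~` (t @^-1` [set t k'])).
  apply/set_nbhsP; exists (~` (t @^-1` [set t k'])); split => //.
    by rewrite openC.
  by move=> l /= -> .
exists (~` (t @` (~` U))), (~` (t @` closure C)); split.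
- by rewrite openC; apply: weak_hausdorff_closed_image; rewrite closedC.
- rewrite openC; apply: weak_hausdorff_closed_image; exact: closed_closure.
- by move=> [l nUl tl]; apply: nUl; exact: kU.
- by move=> [l Cl tl]; exact: (CB _ Cl).
- move=> _ [l _ <-] nU nV; apply: nU; exists l => // Ul; apply: nV.
  by exists l => //; apply: subset_closure; exact: UC.
Qed.

Lemma weak_hausdorff_compact_image (C : set X) :
  range t = C -> compact_hausdorff (set_type C).
Proof.
move=> <-; split.
  apply: compact_set_type; apply: continuous_compact; last by case: chK.
  exact: continuous_subspaceT.
apply: hausdorff_set_type => _ _ [k _ <-] [k' _ <-].
exact: weak_hausdorff_sep.
Qed.

End WeakHausdorff.

(** This replaces the closedness of the diagonal, which fails for the product
    topology of X * X in general. *)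
Lemma weak_hausdorff_closed_equalizer (X K M : topologicalType)
    (t : K -> X) (s : M -> X) :
  weak_hausdorff X -> compact_hausdorff K -> compact_hausdorff M ->
  continuous t -> continuous s ->
  closed [set p : K * M | t p.1 = s p.2].
Proof.
move=> whX chK chM ct cs; rewrite -openC; apply: open_sub_nbhs => -[k m] /= ne.
have [[k' _ k'm]|nm] := pselect (range t (s m)); last first.
  exists (setT `*` (s @^-1` (~` range t))); split => //.
    apply: open_setX; first exact: openT.
    apply: open_preimage => //.
    by rewrite openC; exact: whX.
  by move=> [k1 m1] [_ /= nt] /= e; apply: nt; exists k1.
(* s m is in the image of t: separate it from t k there *)
have [|U [V [oU oV Uk Vk' UV]]] :=
    weak_hausdorff_sep whX chK ct (k := k) (k' := k').
  by rewrite k'm.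
exists ((t @^-1` U) `*` (s @^-1` V)); split.
- by apply: open_setX; exact: open_preimage.
- by split => //=; rewrite -k'm.
- move=> [k1 m1] [/= Uk1 Vm1] e; apply: (UV (t k1)) => //.
  by rewrite e.
Qed.

(** Inclusions of compact Hausdorff subspaces are particular maps from compact
    Hausdorff spaces, which are more convenient test objects. *)
Lemma compactly_generated_open (X : topologicalType) (U : set X) :
  compactly_generated X ->
  (forall (K : topologicalType) (t : K -> X),
    compact_hausdorff K -> continuous t -> open (t @^-1` U)) ->
  open U.
Proof.
move=> [_ cgX] oU; apply: cgX => K chK; apply: oU => //.
exact: continuous_set_val.
Qed.

Lemma compactly_generated_continuous (X Y : topologicalType) (f : X -> Y) :
  compactly_generated X ->
  (forall (K : topologicalType) (t : K -> X),
    compact_hausdorff K -> continuous t -> continuous (f \o t)) ->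
  continuous f.
Proof.
move=> cgX cf; apply/continuousP => V oV; apply: compactly_generated_open => //.
by move=> K t chK ct; exact: (open_preimage (cf K t chK ct) oV).
Qed.

(** * Topologies defined by probes *)

(** The class P is a phantom parameter, there to index the topology put on T. *)
Definition probe_space (T : Type)
  (P : forall K : topologicalType, (K -> T) -> Prop) : Type := T.

Section ProbeSpace.
Variables (T : Type) (P : forall K : topologicalType, (K -> T) -> Prop).
Local Notation PT := (probe_space P).

Definition probe_open (W : set PT) : Prop :=
  forall K : topologicalType, compact_hausdorff K ->
  forall t : K -> T, P t -> open (t @^-1` W).

Let probe_openT : probe_open setT.
Proof. by move=> K _ t _; exact: openT. Qed.

Let probe_openI : setI_closed probe_open.
Proof. by move=> U V oU oV K chK t Pt; apply: openI; [exact: oU|exact: oV]. Qed.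

Let probe_open_bigcup (I : Type) (f : I -> set PT) :
  (forall i, probe_open (f i)) -> probe_open (\bigcup_i f i).
Proof.
move=> of_ K chK t Pt; rewrite preimage_bigcup.
by apply: bigcup_open => i _; exact: of_.
Qed.

HB.instance Definition _ := gen_eqMixin PT.
HB.instance Definition _ := gen_choiceMixin PT.
HB.instance Definition _ :=
  isOpenTopological.Build PT probe_openT probe_openI probe_open_bigcup.

Lemma probe_openE : open = probe_open :> set (set PT).
Proof. by []. Qed.

Lemma probe_continuous (K : topologicalType) (t : K -> PT) :
  compact_hausdorff K -> P t -> continuous t.
Proof. by move=> chK Pt; apply/continuousP => W; apply. Qed.

(** Conversely the probes are the only continuous maps from compact Hausdorff
    spaces; with closed equalizers of probes this gives a compactly generated
    space. *)
Hypothesis continuous_probe : forall (K : topologicalType) (t : K -> PT),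
  compact_hausdorff K -> continuous t -> P t.
Hypothesis probe_closed_equalizer :
  forall (K M : topologicalType) (t : K -> PT) (s : M -> PT),
  compact_hausdorff K -> compact_hausdorff M -> P t -> P s ->
  closed [set p : K * M | t p.1 = s p.2].

(** The preimage by a probe s of the image of t is the projection of the
    equalizer of t and s along the compact space K. *)
Lemma probe_space_weak_hausdorff : weak_hausdorff (PT : topologicalType).
Proof.
move=> K chK t ct; rewrite -openC probe_openE => M chM s Ps.
suff cl : closed [set m | exists k, t k = s m].
  rewrite (_ : _ @^-1` _ = ~` [set m | exists k, t k = s m]) ?openC//.
  by apply/seteqP; split => m nm [k]; [move=> tk; apply: nm; exists k|
    move=> _ tk; apply: nm; exists k].
apply: (@closed_proj2 K M [set p | t p.1 = s p.2]); first by case: chK.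
by apply: probe_closed_equalizer => //; exact: continuous_probe.
Qed.

Lemma probe_space_compactly_generated :
  compactly_generated (PT : topologicalType).
Proof.
split; first exact: probe_space_weak_hausdorff.
move=> U oU; rewrite probe_openE => M chM s Ps.
have cs := probe_continuous chM Ps.
have [z|s' s'E] := @corestrict PT M (range s) s; first by exists z.
rewrite s'E comp_preimage; apply: open_preimage; last first.
  apply: oU.
  exact: (weak_hausdorff_compact_image probe_space_weak_hausdorff chM cs).
by apply: continuous_to_set_type; rewrite -s'E.
Qed.

End ProbeSpace.

(** * Preorders and circulations *)

Notation closure_rt R := (clos_refl_trans _ R).

Lemma closure_rt_map (S T : Type) (R : S -> S -> Prop) (Q : T -> T -> Prop)
    (g : S -> T) :
  (forall x y, R x y -> closure_rt Q (g x) (g y)) ->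
  forall x y, closure_rt R x y -> closure_rt Q (g x) (g y).
Proof.
move=> RQ x y; elim=> [u v /RQ//|u|u v w _ uv _ vw]; first exact: rt_refl.
exact: rt_trans uv vw.
Qed.

Lemma closure_rt_sub (S T : Type) (R : S -> S -> Prop) (Q : T -> T -> Prop)
    (g : S -> T) :
  (forall x y z, Q x y -> Q y z -> Q x z) ->
  (forall x y, R x y -> Q (g x) (g y)) ->
  forall x y, Q (g x) (g x) -> closure_rt R x y -> Q (g x) (g y).
Proof.
move=> Qtr RQ x y Qx Rxy.
have [<-//|//] : g x = g y \/ Q (g x) (g y).
elim: Rxy {Qx} => [u v /RQ|u|u v w _ + _ +]; [by right|by left|].
move=> [->//|uv] [<-|vw]; first by right.
by right; exact: Qtr uv vw.
Qed.

Section StreamTheory.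
Variable X : stream.
Implicit Types (U V : set X) (x y z : X).

Lemma circ_dom U x y : open U -> circ U x y -> U x /\ U y.
Proof. by move=> oU; have [+ _] := circP X => /(_ U oU)[+ _ _]; apply. Qed.

Lemma circ_refl U x : open U -> U x -> circ U x x.
Proof. by move=> oU; have [+ _] := circP X => /(_ U oU)[_ + _]; apply. Qed.

Lemma circ_trans U x y z : open U -> circ U x y -> circ U y z -> circ U x z.
Proof. by move=> oU; have [+ _] := circP X => /(_ U oU)[_ _ +]; apply. Qed.

Lemma circ_bigcup (O : set (set X)) x y : O `<=` open ->
  circ (\bigcup_(U in O) U) x y ->
  closure_rt (fun a b => exists2 U, O U & circ U a b) x y.
Proof.
by move=> oO; have [_ /(_ O oO x y)[+ _]] := circP X => /[apply] -[].
Qed.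

Lemma circ_mono U V x y : open U -> open V -> U `<=` V ->
  circ U x y -> circ V x y.
Proof.
move=> oU oV UV Uxy; have [_ cX] := circP X.
have UVE : \bigcup_(W in [set U; V]) W = V.
  by rewrite bigcup_setU1 bigcup_set1; exact/setUidPr.
have [Ux Uy] := circ_dom oU Uxy.
rewrite -UVE; apply/cX; first by move=> W [->|->].
rewrite /preorder_join UVE; split; [exact: UV|exact: UV|].
by apply: rt_step; exists U => //; left.
Qed.

Lemma circ_closure (R : X -> X -> Prop) U x y : open U -> U x ->
  (forall a b, R a b -> circ U a b) -> closure_rt R x y -> circ U x y.
Proof.
move=> oU Ux RU; apply: (closure_rt_sub (g := id)) => //.
  by move=> a b c; exact: circ_trans.
exact: circ_refl.
Qed.

End StreamTheory.

(** The condition on stream maps other than continuity, isolated so as to be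
    applied to bare functions. *)
Definition monotone_flow (X Y : stream) (f : X -> Y) : Prop :=
  forall U : set Y, open U -> forall x y,
    circ (f @^-1` U) x y -> circ U (f x) (f y).

Lemma monotone_flow_comp (X Y Z : stream) (g : Y -> Z) (f : X -> Y) :
  continuous g -> monotone_flow f -> monotone_flow g -> monotone_flow (g \o f).
Proof.
move=> cg mf mg U oU x y fgxy; apply: mg => //; apply: mf => //.
exact: open_preimage.
Qed.

Lemma monotone_flow_cst (X Y : stream) (y : Y) : monotone_flow (fun _ : X => y).
Proof.
move=> U oU x x' Uxx'; apply: circ_refl => //.
have oV : open ((fun _ : X => y) @^-1` U).
  by apply: open_preimage => //; exact: cst_continuous.
by have [] := circ_dom oV Uxx'.
Qed.

(** * Generated circulations *)

Section Generated.
Variables (X : topologicalType) (G : forall Z : stream, (Z -> X) -> Prop).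

Inductive generated_step (U : set X) : X -> X -> Prop :=
  GeneratedStep (Z : stream) (f : Z -> X) (z z' : Z) :
    G f -> circ (f @^-1` U) z z' -> generated_step U (f z) (f z').

Definition generated (U : set X) (x y : X) : Prop :=
  [/\ U x, U y & closure_rt (generated_step U) x y].

Hypothesis contG : forall (Z : stream) (f : Z -> X), G f -> continuous f.

(** Preimages commute with unions, so that each step of a chain over a union of
    open sets splits, in the source of its generator, into steps over the
    members. *)
Lemma generated_circulation : is_circulation generated.
Proof.
split=> [U oU|O oO x y]; first split.
- by move=> x y [].
- by move=> x Ux; split => //; exact: rt_refl.
- by move=> x y z [Ux _ xy] [_ Uz yz]; split => //; exact: rt_trans xy yz.
- have oUO : open (\bigcup_(U in O) U) by exact: bigcup_open.
  split=> -[Ux Uy Uxy]; split => //; apply: (closure_rt_map (g := id)) Uxy.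
    move=> _ _ [Z f z z' Gf fzz'].
    have cf := contG Gf.
    have OE : f @^-1` (\bigcup_(U in O) U) =
        \bigcup_(V in [set f @^-1` U | U in O]) V.
      by rewrite preimage_bigcup bigcup_image.
    rewrite OE in fzz'; apply: closure_rt_map (circ_bigcup _ fzz').
      move=> a b [_ [U OU <-] Uab]; apply: rt_step; exists U => //.
      have [Ua Ub] := circ_dom (open_preimage cf (oO _ OU)) Uab.
      by split => //; apply: rt_step; exact: GeneratedStep.
    by move=> _ [U OU <-]; exact: open_preimage (oO _ OU).
  move=> a b [U OU [Ua _ ab]].
  apply: (closure_rt_map (g := id)) ab => _ _ [Z f z z' Gf fzz'].
  apply: rt_step; apply: GeneratedStep => //.
  apply: circ_mono fzz'; do ?[exact: open_preimage (contG Gf) _].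
    by apply: open_preimage (contG Gf) _; exact: oO.
  by move=> t ft; exists U.
Qed.

Definition generated_stream : stream := Stream generated_circulation.

Lemma generated_monotone_flow (Z : stream) (f : Z -> X) : G f ->
  @monotone_flow Z generated_stream f.
Proof.
move=> Gf U oU z z' fzz'.
have [Uz Uz'] := circ_dom (open_preimage (contG Gf) oU) fzz'.
by split => //; apply: rt_step; exact: GeneratedStep.
Qed.

Lemma monotone_flow_generated (Y : stream) (g : X -> Y) :
  (forall (Z : stream) (f : Z -> X), G f -> monotone_flow (g \o f)) ->
  @monotone_flow generated_stream Y g.
Proof.
move=> mg U oU x y [Ux _]; apply: (closure_rt_sub (g := g)).
- by move=> a b c; exact: circ_trans.
- by move=> _ _ [Z f z z' Gf fzz']; exact: (mg Z f Gf).
- exact: circ_refl.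
Qed.

End Generated.

(** The identities of X as maps from the circulations below c: the
    cosheafification of c is generated by them. *)
Inductive below (X : topologicalType) (c : set X -> X -> X -> Prop) :
    forall Z : stream, (Z -> X) -> Prop :=
  Below (d : set X -> X -> X -> Prop) (dP : is_circulation d) :
    (forall W, open W -> forall x y, d W x y -> c W x y) ->
    @below X c (Stream dP) id.

Section Cosheafification.
Variables (X : topologicalType) (c : set X -> X -> X -> Prop).
Hypothesis crefl : forall W, open W -> forall x, W x -> c W x x.

Lemma below_continuous (Z : stream) (f : Z -> X) : below c f -> continuous f.
Proof. by case=> d dP _ x; exact: cvg_id. Qed.

Lemma cosheafificationE : cosheafification c = generated (below c).
Proof.
apply/funext => U; apply/funext => x; apply/funext => y; apply/propext; split.
  move=> [[d _ Ux] [e _ Uy] xy]; split => // {d e Ux Uy}.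
  apply: (closure_rt_map (g := id)) xy => a b [e [eP ec] eab]; apply: rt_step.
  exact: (@GeneratedStep _ (below c) U (Stream eP) id).
move=> [Ux Uy xy].
(* equality is a circulation below c, so the join defining the
   cosheafification is over a nonempty family and is reflexive *)
pose none (Z : stream) (f : Z -> X) := False.
have nP : is_circulation (generated none) by exact: generated_circulation.
have nc W : open W -> forall a b, generated none W a b -> c W a b.
  move=> oW a b [Wa _ ab]; suff <- : a = b by exact: crefl.
  by elim: ab {Wa} => [u v []//|//|u v w _ -> _ ->].
split; [by exists (generated none)|by exists (generated none)|].
apply: (closure_rt_map (g := id)) xy => _ _ [Z f z z' bf].
case: Z f / bf z z' => d dP dc z z' dzz'.
by apply: rt_step; exists d.
Qed.

End Cosheafification.

Inductive only (X : topologicalType) (Z : stream) (f : Z -> X) :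
    forall Y : stream, (Y -> X) -> Prop :=
  Only : only f f.

(** * Substreams *)

Section Substream.
Variables (X : stream) (A : set X).

Lemma pullback_refl (W : set (set_type A)) : open W -> forall a, W a ->
  pullback set_val (@circ X) W a a.
Proof.
move=> oW a Wa; split => // V oV WV; apply: circ_refl => //.
by apply: WV; exists a.
Qed.

Lemma substream_circulationP :
  is_circulation (substream_circulation (@circ X) (A := A)).
Proof.
rewrite /substream_circulation cosheafificationE; last exact: pullback_refl.
by apply: generated_circulation; exact: below_continuous.
Qed.

Definition substream : stream := Stream substream_circulationP.

Lemma substream_val_monotone_flow :
  monotone_flow (@set_val X A : substream -> X).
Proof.
move=> U oU a b; rewrite /= /substream_circulation.
rewrite cosheafificationE; last exact: pullback_refl.
case=> Ua Ub ab; apply: (closure_rt_sub (g := set_val)) ab.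
- by move=> x y z; exact: circ_trans.
- move=> _ _ [Z f z z' bf]; case: Z f / bf z z' => d dP dc z z' dzz'.
  have oV : open (@set_val X A @^-1` U).
    exact: open_preimage (@continuous_set_val _ _) oU.
  by have [_ _] := dc _ oV _ _ dzz'; apply => // _ [x Ux <-].
- exact: circ_refl.
Qed.

(** Universal property of the substream: the circulation generated by f alone
    lies below the pullback, hence below its cosheafification. *)
Lemma monotone_flow_to_substream (Z : stream) (f : Z -> substream) :
  continuous f -> monotone_flow (set_val \o f : Z -> X) -> monotone_flow f.
Proof.
move=> cf mf W oW z z' fzz'.
have ofc (Y : stream) (g : Y -> substream) : only f g -> continuous g by case.
have fP := generated_circulation ofc.
have [Wz Wz'] := circ_dom (open_preimage cf oW) fzz'.
rewrite /= /substream_circulation cosheafificationE; last exact: pullback_refl.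
split => //; apply: rt_step.
apply: (@GeneratedStep _ _ _ (Stream fP) id).
  constructor=> V oV x y [Vx Vy xy]; split => // U oU VU.
  have cof : continuous (set_val \o f).
    by apply: continuous_funcomp cf; exact: continuous_set_val.
  apply: (closure_rt_sub (g := set_val)) xy.
  - by move=> ? ? ?; exact: circ_trans.
  - move=> _ _ [Y g t t' fg]; case: Y g / fg t t' => t t' ftt'; apply: mf => //.
    apply: circ_mono ftt'; do ?[exact: open_preimage].
    by move=> u Vu; apply: VU; exists (f u).
  - by apply: circ_refl => //; apply: VU; exists x.
by split => //; apply: rt_step; exact: (@GeneratedStep _ (@only _ _ f) W Z f).
Qed.

End Substream.

(** * k-circulations *)

Section KCirculation.
Variable X : stream.

Lemma restr_preorder_sub (L U : set X) x y : open U -> L `<=` U ->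
  restr_preorder (@circ X) L x y -> circ U x y.
Proof.
move=> oU LU [a [b [<- <- ab]]]; apply: (substream_val_monotone_flow oU).
apply: (@circ_mono (substream L) setT) ab; first exact: openT.
  exact: open_preimage (@continuous_set_val _ _) oU.
by move=> c _ /=; apply: LU; exact: set_valP.
Qed.

Lemma compact_hausdorff_set1 (T : topologicalType) (x : T) :
  compact_hausdorff (set_type [set x]).
Proof.
split; first by apply: compact_set_type; exact: compact_set1.
by apply: hausdorff_set_type => y z -> ->.
Qed.

Lemma k_circulation_closure (U : set X) x y :
  is_k_circulation (@circ X) -> open U -> circ U x y ->
  closure_rt (fun a b =>
    exists2 L, L `<=` U /\ compact_hausdorff (set_type L) &
      restr_preorder (@circ X) L a b) x y.
Proof. by move=> kX oU /(kX U oU)[]. Qed.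

(** The restrictions to subsets of U always lie below the circulation on U, so
    only one inclusion has to be checked. *)
Lemma k_circulation_of_closure :
  (forall (U : set X) x y, open U -> circ U x y ->
    closure_rt (fun a b =>
      exists2 L, L `<=` U /\ compact_hausdorff (set_type L) &
        restr_preorder (@circ X) L a b) x y) ->
  is_k_circulation (@circ X).
Proof.
move=> kX U oU x y.
have pt z : U z -> (\bigcup_(L in [set L : set X | L `<=` U /\
    compact_hausdorff (set_type L)]) id L) z.
  move=> Uz; exists [set z] => //; split; first by move=> _ ->.
  exact: compact_hausdorff_set1.
split=> [Uxy|[[L [LU _] Lx] _ xy]].
  have [Ux Uy] := circ_dom oU Uxy.
  by split; [exact: pt|exact: pt|exact: kX].
apply: (circ_closure oU (LU _ Lx)) xy => a b [M [MU _]].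
exact: restr_preorder_sub.
Qed.

End KCirculation.

Section GeneratedK.
Variables (X : topologicalType) (G : forall Z : stream, (Z -> X) -> Prop).
Hypothesis contG : forall (Z : stream) (f : Z -> X), G f -> continuous f.

(** A compact Hausdorff L inside the source of a generator f has a compact
    Hausdorff image, and f restricts to a stream map between the substreams. *)
Lemma generated_k_circulation : weak_hausdorff X ->
  (forall (Z : stream) (f : Z -> X), G f -> is_k_circulation (@circ Z)) ->
  is_k_circulation (@circ (generated_stream contG)).
Proof.
move=> whX kG; apply: k_circulation_of_closure => U x y oU [_ _].
apply: (closure_rt_map (g := id)) => _ _ [Z f z z' Gf fzz'].
have cf := contG Gf.
apply: closure_rt_map
  (k_circulation_closure (kG Z f Gf) (open_preimage cf oU) fzz').
move=> a b [L [LU chL] [a' [b' [<- <- ab]]]]; apply: rt_step.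
have cfL : continuous (f \o @set_val Z L).
  by apply: continuous_funcomp => //; exact: continuous_set_val.
have rL : range (f \o @set_val Z L) = f @` L.
  apply/seteqP; split=> [_ [l _ <-]|_ [l Ll <-]].
    by exists (set_val l) => //; exact: set_valP.
  by exists (SigSub (mem_set Ll)).
exists (f @` L).
  split; first by move=> _ [l /LU ? <-].
  refine (weak_hausdorff_compact_image whX chL cfL rL).
have [l|f' f'E] := @corestrict X _ (f @` L) (f \o @set_val Z L).
  by rewrite -rL; exists l.
exists (f' a'), (f' b'); split.
- by have := congr1 (@^~ a') f'E.
- by have := congr1 (@^~ b') f'E.
have cf' : continuous f' by apply: continuous_to_set_type; rewrite -f'E.
apply: (@monotone_flow_to_substream (generated_stream contG) (f @` L)
  (substream L) f' cf' _ _ openT _ _ ab).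
have -> : set_val \o f' = f \o @set_val Z L by [].
apply: (@monotone_flow_comp (substream L) Z (generated_stream contG)) => //.
  exact: substream_val_monotone_flow.
exact: generated_monotone_flow.
Qed.

End GeneratedK.

(** * Products *)

Section KProduct.
Variables X Y : topologicalType.

Definition pair_probe (K : topologicalType) (t : K -> X * Y) : Prop :=
  continuous (fst \o t) /\ continuous (snd \o t).

(** The product of compactly generated spaces: its topology is finer than the
    product topology, with the same maps from compact Hausdorff spaces. *)
Definition kprod : Type := probe_space pair_probe.
HB.instance Definition _ := Topological.on kprod.

Lemma kprod_fst_continuous : continuous (fst : kprod -> X).
Proof.
apply/continuousP => U oU; rewrite probe_openE => K chK t [ct _].
exact: (open_preimage ct oU).
Qed.

Lemma kprod_snd_continuous : continuous (snd : kprod -> Y).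
Proof.
apply/continuousP => U oU; rewrite probe_openE => K chK t [_ ct].
exact: (open_preimage ct oU).
Qed.

Lemma kprod_pair_continuous (Z : topologicalType) (f : Z -> X) (g : Z -> Y) :
  compactly_generated Z -> continuous f -> continuous g ->
  continuous (fun z => (f z, g z) : kprod).
Proof.
move=> cgZ cf cg; apply: compactly_generated_continuous => // K t chK ct.
by apply: probe_continuous => //; split;
  [exact: (continuous_funcomp cf ct)|exact: (continuous_funcomp cg ct)].
Qed.

Lemma kprod_compactly_generated :
  weak_hausdorff X -> weak_hausdorff Y -> compactly_generated kprod.
Proof.
move=> whX whY; apply: probe_space_compactly_generated.
  move=> K t chK ct; split.
    exact: (continuous_funcomp kprod_fst_continuous ct).
  exact: (continuous_funcomp kprod_snd_continuous ct).
move=> K M t s chK chM [ct1 ct2] [cs1 cs2].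
rewrite (_ : [set p | _] =
    [set p : K * M | (fst \o t) p.1 = (fst \o s) p.2] `&`
    [set p : K * M | (snd \o t) p.1 = (snd \o s) p.2]).
  by apply: closedI; apply: weak_hausdorff_closed_equalizer.
apply/seteqP; split => -[k m] /=; first by move=> ->.
by case: (t k) (s m) => [x y] [x' y'] /= [-> ->].
Qed.

End KProduct.

Inductive slice (X Y : stream) : forall Z : stream, (Z -> kprod X Y) -> Prop :=
| SliceLeft (y : Y) : @slice X Y X (fun x => (x, y))
| SliceRight (x : X) : @slice X Y Y (fun y => (x, y)).

Section FlowingProduct.
Variables (X Y : stream).
Variables (cfX : compactly_flowing X) (cfY : compactly_flowing Y).

Lemma slice_continuous (Z : stream) (f : Z -> kprod X Y) :
  slice f -> continuous f.
Proof.
have [[cgX _] [cgY _]] := (cfX, cfY).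
by case=> [y|x]; apply: kprod_pair_continuous => // ?;
  do ?[exact: cvg_cst|exact: cvg_id].
Qed.

Definition prod_stream : stream := generated_stream slice_continuous.

Lemma prod_stream_flowing : compactly_flowing prod_stream.
Proof.
have [[[whX _] kX] [[whY _] kY]] := (cfX, cfY).
have cgP := kprod_compactly_generated whX whY; split => //.
apply: generated_k_circulation; first by case: cgP.
by move=> Z f [].
Qed.

Lemma prod_fst_monotone_flow : monotone_flow (fst : prod_stream -> X).
Proof.
apply: monotone_flow_generated => Z f [y|x]; first by [].
exact: monotone_flow_cst.
Qed.

Lemma prod_snd_monotone_flow : monotone_flow (snd : prod_stream -> Y).
Proof.
apply: monotone_flow_generated => Z f [y|x]; last by [].
exact: monotone_flow_cst.
Qed.

(** Universal property of the product. As Z has a k-circulation, it suffices to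
    consider h on a compact Hausdorff substream S of Z, and there to cover S by
    open sets N on which a flow line can be replaced by a horizontal move
    followed by a vertical one. *)
Lemma prod_pair_monotone_flow (Z : stream) (h : Z -> prod_stream) :
  is_k_circulation (@circ Z) -> continuous h ->
  monotone_flow (fst \o h : Z -> X) -> monotone_flow (snd \o h : Z -> Y) ->
  monotone_flow h.
Proof.
move=> kZ ch m1 m2 W oW z z' hzz'.
have [Wz _] := circ_dom (open_preimage ch oW) hzz'.
have Whz : circ W (h z) (h z) by exact: circ_refl.
have := k_circulation_closure kZ (open_preimage ch oW) hzz'.
apply: (closure_rt_sub (g := h)) Whz; first by move=> ? ? ?; exact: circ_trans.
move=> {hzz' Wz} _ _ [L [LW chL] [a [b [<- <- ab]]]].
pose S := substream L; pose t := h \o @set_val Z L : S -> prod_stream.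
have ct : continuous t.
  exact: continuous_funcomp ch (@continuous_set_val _ _).
have mt1 : monotone_flow (fst \o t : S -> X).
  apply: (@monotone_flow_comp S Z X (fst \o h)) => //.
    exact: (continuous_funcomp (@kprod_fst_continuous _ _)).
  exact: substream_val_monotone_flow.
have mt2 : monotone_flow (snd \o t : S -> Y).
  apply: (@monotone_flow_comp S Z Y (snd \o h)) => //.
    exact: (continuous_funcomp (@kprod_snd_continuous _ _)).
  exact: substream_val_monotone_flow.
have ct1 : continuous (fst \o t : S -> X).
  exact: (continuous_funcomp (@kprod_fst_continuous _ _)).
have ct2 : continuous (snd \o t : S -> Y).
  exact: (continuous_funcomp (@kprod_snd_continuous _ _)).
have Wt (l : S) : W (t l) by apply: LW; exact: set_valP.
(* a probe, as S * S is compact Hausdorff; the value at (l, l) is t l *)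
pose mix (p : S * S) : prod_stream := ((t p.1).1, (t p.2).2).
have cmix : continuous mix.
  apply: probe_continuous; first exact: compact_hausdorff_prod.
  split.
    exact: continuous_funcomp ct1 (@continuous_fst _ _).
  exact: continuous_funcomp ct2 (@continuous_snd _ _).
pose O :=
  [set N : set S | open N /\ forall l l', N l -> N l' -> W (mix (l, l'))].
have OT : \bigcup_(N in O) N = setT.
  apply/seteqP; split => // l _.
  have Wl : (mix @^-1` W) (l, l).
    by rewrite /mix /= -surjective_pairing; exact: Wt.
  have [N1 [N2 [oN1 oN2 N1l N2l NW]]] :=
    open_prod_box (open_preimage cmix oW) Wl.
  exists (N1 `&` N2) => //; split; first exact: openI.
  by move=> k k' [N1k _] [_ N2k']; exact: (NW (k, k')).
have oO : O `<=` open by move=> N [].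
have Wta : circ W (t a) (t a) by exact: circ_refl.
have ab' : circ (\bigcup_(N in O) N) (a : S) b by rewrite OT.
rewrite -[h _]/(t a) -[h _]/(t b).
apply: (closure_rt_sub (g := t)) Wta (circ_bigcup oO ab').
  by move=> ? ? ?; exact: circ_trans.
move=> l l' [N [oN NW] Nll'].
have [Nl Nl'] := circ_dom oN Nll'.
have move_left : circ W (mix (l, l)) (mix (l', l)).
  have sl := SliceLeft X (t l).2; have csl := slice_continuous sl.
  have oV := open_preimage csl oW.
  refine (@generated_monotone_flow _ _ slice_continuous _ _ sl W oW
    (t l).1 (t l').1 _).
  apply: (mt1 _ oV); apply: circ_mono Nll' => //.
    exact: open_preimage.
  by move=> k Nk; exact: (NW k l).
have move_right : circ W (mix (l', l)) (mix (l', l')).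
  have sr := SliceRight Y (t l').1; have csr := slice_continuous sr.
  have oV := open_preimage csr oW.
  refine (@generated_monotone_flow _ _ slice_continuous _ _ sr W oW
    (t l).2 (t l').2 _).
  apply: (mt2 _ oV); apply: circ_mono Nll' => //.
    exact: open_preimage.
  by move=> k Nk; exact: (NW l' k).
have := circ_trans oW move_left move_right.
by rewrite /mix /= -!surjective_pairing.
Qed.

End FlowingProduct.

(** * Exponentials *)

Section KExponential.
Variables (A B : stream) (whB : weak_hausdorff B).

(** Continuity of the transpose is only required along compact Hausdorff M: this
    is continuity on the compactly generated product of K and A. *)
Definition eval_probe (K : topologicalType) (t : K -> stream_map A B) : Prop :=
  forall (M : topologicalType) (a : M -> A),
  compact_hausdorff M -> continuous a ->
  continuous (fun p : K * M => t p.1 (a p.2)).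

Definition kexp : Type := probe_space eval_probe.
HB.instance Definition _ := Topological.on kexp.

(** The sets of the compact-open topology are open, by the tube lemma. *)
Lemma kexp_compact_open (M : topologicalType) (a : M -> A)
    (C : set M) (V : set B) :
  compact_hausdorff M -> continuous a -> compact C -> open V ->
  open [set e : kexp | forall m, C m -> V (smap e (a m))].
Proof.
move=> chM ca cC oV; rewrite probe_openE => K chK t Pt.
exact: (compact_forall_open cC (open_preimage (Pt M a chM ca) oV)).
Qed.

(** Around (k, m), choose a closed neighbourhood N of m which t k maps into V;
    the maps sending N into V form an open set. *)
Lemma kexp_continuous_probe (K : topologicalType) (t : K -> kexp) :
  continuous t -> eval_probe t.
Proof.
move=> ct M a chM ca; apply/continuousP => V oV; apply: open_sub_nbhs.
move=> -[k m] /= Vkm; have [cM hM] := chM.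
have /= cta : continuous (smap (t k) \o a).
  by apply: continuous_funcomp => //; exact: smap_continuous.
have nV : nbhs m ((smap (t k) \o a) @^-1` V).
  by apply: open_nbhs_nbhs; split => //; exact: (open_preimage cta oV).
have [N Nm NV] := compact_regular hM cM (filterT : nbhs m setT) nV.
pose W : set kexp :=
  [set e | forall m, closure N m -> V (smap e (a m))].
have oW : open W.
  apply: kexp_compact_open => //.
  exact: (subclosed_compact (@closed_closure _ _) cM).
exists ((t @^-1` W) `*` (interior N)); split.
- by apply: open_setX; [exact: open_preimage|exact: open_interior].
- by split => //= m' /NV.
- move=> [k1 m1] [/= Wk1 Nm1]; apply: Wk1.
  by apply: subset_closure; exact: interior_subset.
Qed.

Lemma eval_probe_at (K : topologicalType) (t : K -> stream_map A B) (a : A) :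
  compact_hausdorff K -> eval_probe t -> continuous (fun k => t k a).
Proof.
move=> chK /(_ K (fun _ => a) chK (@cst_continuous _ _ a)) ct.
have := continuous_funcomp ct (@continuous_diag K).
exact.
Qed.

Lemma kexp_compactly_generated : compactly_generated kexp.
Proof.
apply: probe_space_compactly_generated.
  by move=> K t _; exact: kexp_continuous_probe.
move=> K M t s chK chM Pt Ps.
rewrite (_ : [set p | _] =
    \bigcap_(a in [set: A])
      [set p : K * M | smap (t p.1) a = smap (s p.2) a]).
  apply: closed_bigI => a _.
  exact: (@weak_hausdorff_closed_equalizer B K M
    (fun k => smap (t k) a) (fun m => smap (s m) a)
    whB chK chM
    (eval_probe_at chK Pt (a := a)) (eval_probe_at chM Ps (a := a))).
apply/seteqP; split => -[k m] /=; first by move=> e a _ /=; rewrite e.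
by move=> e; apply: stream_map_eq; apply/funext => a; exact: e.
Qed.

Lemma kexp_eval_continuous :
  continuous (fun p : kprod kexp A => smap p.1 p.2).
Proof.
apply/continuousP => V oV; rewrite probe_openE => K chK t [ct1 ct2].
have ce := kexp_continuous_probe ct1 chK ct2.
have := continuous_funcomp ce (@continuous_diag K).
by move=> /open_preimage-/(_ _ oV).
Qed.

Lemma kexp_curry_continuous (X : topologicalType) (h : X -> kexp) :
  compactly_generated X ->
  continuous (fun p : kprod X A => smap (h p.1) p.2) -> continuous h.
Proof.
move=> cgX cg; apply: compactly_generated_continuous => // K t chK ct.
apply: probe_continuous => // M a chM ca.
have cta : continuous (fun p : K * M => (t p.1, a p.2) : kprod X A).
  apply: probe_continuous; first exact: compact_hausdorff_prod.
  split; [exact: continuous_funcomp ct (@continuous_fst _ _)|].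
  exact: continuous_funcomp ca (@continuous_snd _ _).
exact: (continuous_funcomp cg cta).
Qed.

End KExponential.

Section FlowingExponential.
Variables (A B : stream).
Variables (cfA : compactly_flowing A) (cfB : compactly_flowing B).

Record pointwise_flow (Z : stream) (h : Z -> kexp A B) : Prop := PointwiseFlow {
  pointwise_flowing : compactly_flowing Z;
  pointwise_continuous : continuous h;
  pointwise_monotone_flow :
    forall a : A, monotone_flow (fun z => smap (h z) a) }.

Definition exp_stream : stream := generated_stream pointwise_continuous.

Lemma exp_stream_flowing : compactly_flowing exp_stream.
Proof.
have [[whB _] _] := cfB.
have cgE := kexp_compactly_generated A whB; split => //.
apply: generated_k_circulation; first by case: cgE.
by move=> Z h [[]].
Qed.

(** Both kinds of slices of the product have to be checked: on B^A * {a} by the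
    choice of the generators of B^A, on {e} * A because e is a stream map. *)
Lemma exp_eval_monotone_flow :
  monotone_flow (fun p : prod_stream exp_stream_flowing cfA =>
    smap p.1 p.2).
Proof.
apply: monotone_flow_generated => Z f [a|e].
  by apply: monotone_flow_generated => Y h /pointwise_monotone_flow; apply.
by move=> U oU a a'; exact: smapP.
Qed.

End FlowingExponential.

(** * Cartesian closedness *)

(** The circulation of the point is generated by the empty family. *)
Lemma terminal_flowing_stream : exists T : stream, compactly_flowing T /\
  forall X : stream, exists! _ : stream_map X T, True.
Proof.
pose pt := probe_space (fun (K : topologicalType) (_ : K -> unit) => True).
pose none (Z : stream) (f : Z -> pt) := False.
have cnone (Z : stream) (f : Z -> pt) : none Z f -> continuous f by [].
have cg : compactly_generated pt.
  apply: probe_space_compactly_generated => // K M t s _ _ _ _.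
  rewrite (_ : [set p | _] = setT); first exact: closedT.
  by apply/seteqP; split => // -[k m] _ /=; case: (t k) (s m) => [] [].
exists (generated_stream cnone); split.
  by split => //; apply: generated_k_circulation; first by case: cg.
move=> X.
have cf : continuous (fun _ : X => tt : pt) by exact: cst_continuous.
exists (@StreamMap X (generated_stream cnone) _ cf
  (@monotone_flow_cst X (generated_stream cnone) tt)).
split => // f _; apply: stream_map_eq; apply/funext => x /=.
by case: (f x : unit).
Qed.

Section Pairing.
Variables (X Y : stream).
Variables (cfX : compactly_flowing X) (cfY : compactly_flowing Y).

Definition prod_fst : stream_map (prod_stream cfX cfY) X :=
  @StreamMap (prod_stream cfX cfY) X _ (@kprod_fst_continuous X Y)
    (@prod_fst_monotone_flow X Y cfX cfY).

Definition prod_snd : stream_map (prod_stream cfX cfY) Y :=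
  @StreamMap (prod_stream cfX cfY) Y _ (@kprod_snd_continuous X Y)
    (@prod_snd_monotone_flow X Y cfX cfY).

Lemma prod_pair_exists (Z : stream) (f : stream_map Z X) (g : stream_map Z Y) :
  compactly_flowing Z ->
  exists h : stream_map Z (prod_stream cfX cfY), forall z, h z = (f z, g z).
Proof.
move=> [cgZ kZ].
have ch : continuous (fun z => (f z, g z) : kprod X Y).
  apply: kprod_pair_continuous => //; exact: smap_continuous.
exists (@StreamMap Z (prod_stream cfX cfY) _ ch
  (@prod_pair_monotone_flow X Y cfX cfY Z _ kZ ch
    (@smapP _ _ f) (@smapP _ _ g))).
by [].
Qed.

End Pairing.

Section Currying.
Variables (A B : stream).
Variables (cfA : compactly_flowing A) (cfB : compactly_flowing B).

Definition exp_eval :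
    stream_map (prod_stream (exp_stream_flowing A cfB) cfA) B :=
  @StreamMap (prod_stream (exp_stream_flowing A cfB) cfA) B _
    (@kexp_eval_continuous A B) (@exp_eval_monotone_flow A B cfA cfB).

Lemma curry_exists (X : stream) (cfX : compactly_flowing X)
    (g : stream_map (prod_stream cfX cfA) B) :
  exists h : stream_map X (exp_stream A B),
    forall x a, smap (h x) a = g (x, a).
Proof.
have cs (x : X) : continuous (fun a => (x, a) : kprod X A).
  exact: slice_continuous cfX cfA _ _ (SliceRight A x).
have sm (x : X) : exists e : stream_map A B, forall a, e a = g (x, a).
  unshelve eexists (@StreamMap A B (fun a => g (x, a)) _ _) => //.
    exact: (continuous_funcomp (@smap_continuous _ _ g) (cs x)).
  apply: (@monotone_flow_comp A (prod_stream cfX cfA) B g).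
  - exact: smap_continuous.
  - exact: generated_monotone_flow (SliceRight A x).
  - exact: smapP.
pose h x : kexp A B := projT1 (cid (sm x)).
have hE x a : smap (h x) a = g (x, a).
  exact: (projT2 (cid (sm x))).
have gE : (fun p : kprod X A => smap (h p.1) p.2) = g.
  by apply/funext => -[x a]; rewrite hE.
have ch : continuous h.
  apply: kexp_curry_continuous; first exact: (proj1 cfX).
  by rewrite gE; exact: (@smap_continuous _ _ g).
have ph : pointwise_flow h.
  split => // a.
  rewrite (_ : (fun z => _) =
      g \o (fun x => (x, a) : prod_stream cfX cfA)).
    apply: (@monotone_flow_comp X (prod_stream cfX cfA) B).
    - exact: smap_continuous.
    - exact: generated_monotone_flow (SliceLeft X a).
    - exact: smapP.
  by apply/funext => x; rewrite hE.
by exists (@StreamMap X (exp_stream A B) h ch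
  (@generated_monotone_flow _ _ _ _ _ ph)).
Qed.

End Currying.

Section Category.
Local Notation S' := compactly_flowing_category.

Definition flowing_prod (A B : S') : S' :=
  exist _ (prod_stream (proj2_sig A) (proj2_sig B))
    (prod_stream_flowing (proj2_sig A) (proj2_sig B)).

Definition flowing_exp (A B : S') : S' :=
  exist _ (exp_stream (sval A) (sval B))
    (exp_stream_flowing (sval A) (proj2_sig B)).

Definition flowing_fst (A B : S') : Hom (flowing_prod A B) A :=
  prod_fst (proj2_sig A) (proj2_sig B).

Definition flowing_snd (A B : S') : Hom (flowing_prod A B) B :=
  prod_snd (proj2_sig A) (proj2_sig B).

Definition flowing_eval (A B : S') : Hom (flowing_prod (flowing_exp A B) A) B :=
  exp_eval (proj2_sig A) (proj2_sig B).

Lemma comp_app (A B D : S') (g : Hom B D) (f : Hom A B) x :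
  smap (comp g f) x = smap g (smap f x).
Proof. by []. Qed.

Lemma flowing_hom_ext (A B : S') (f g : Hom A B) :
  (forall x, smap f x = smap g x) -> f = g.
Proof. by move=> fg; apply: stream_map_eq; apply/funext. Qed.

Lemma flowing_pair_eta (A B Z : S') (k : Hom Z (flowing_prod A B)) z :
  smap k z = (smap (comp (flowing_fst A B) k) z,
              smap (comp (flowing_snd A B) k) z).
Proof. exact: surjective_pairing. Qed.

Lemma flowing_prod_product (A B : S') :
  is_product (flowing_fst A B) (flowing_snd A B).
Proof.
move=> X f g.
have [h hE] := prod_pair_exists (proj2_sig A) (proj2_sig B) f g (proj2_sig X).
exists h; split.
  by split; apply: flowing_hom_ext => x; rewrite comp_app hE.
move=> k [kf kg]; apply: flowing_hom_ext => x.
by rewrite hE -kf -kg [RHS]flowing_pair_eta.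
Qed.

(** The product Q of X and A is arbitrary; u is the isomorphism to it from the
    product constructed above, with inverse the pairing of p' and q'. *)
Lemma flowing_exp_exponential (A B : S') :
  is_exponential (flowing_fst (flowing_exp A B) A)
    (flowing_snd (flowing_exp A B) A) (flowing_eval A B).
Proof.
move=> X Q p' q' Qprod g.
have [u [[p'u q'u] _]] :=
  Qprod (flowing_prod X A) (flowing_fst X A) (flowing_snd X A).
have p'uE x a : smap p' (smap u (x, a)) = x by rewrite -comp_app p'u.
have q'uE x a : smap q' (smap u (x, a)) = a by rewrite -comp_app q'u.
have uK z : smap u (smap p' z, smap q' z) = z.
  have [v [[p'v q'v] _]] := flowing_prod_product p' q'.
  have [w [_ w_uniq]] := Qprod Q p' q'.
  have vE : smap v z = (smap p' z, smap q' z).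
    by rewrite flowing_pair_eta p'v q'v.
  rewrite -vE -comp_app -(w_uniq (comp u v)) ?(w_uniq (idmap Q)) //.
    by rewrite !comp_idr.
  by rewrite !compA p'u q'u.
have [h hE] := @curry_exists (sval A) (sval B) (proj2_sig A) (sval X)
  (proj2_sig X) (comp g u : Hom (flowing_prod X A) B).
exists (h : Hom X (flowing_exp A B)); split.
  have [k [[pk qk] _]] :=
    flowing_prod_product (comp (h : Hom X (flowing_exp A B)) p') q'.
  exists k; split => //; apply: flowing_hom_ext => z.
  have kE : smap k z = (smap h (smap p' z), smap q' z).
    by rewrite flowing_pair_eta pk qk.
  by rewrite comp_app kE; rewrite [LHS]hE comp_app uK.
move=> h2 [k2 [pk2 qk2 ek2]]; apply: flowing_hom_ext => x.
apply: stream_map_eq; apply/funext => a.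
rewrite [LHS]hE comp_app -ek2 comp_app.
have -> : smap k2 (smap u (x, a)) = (smap h2 x, a); last by [].
by rewrite flowing_pair_eta pk2 qk2 comp_app p'uE q'uE.
Qed.

End Category.

Theorem theorem5p12 : cartesian_closed compactly_flowing_category.
Proof.
split.
- have [T [cfT termT]] := terminal_flowing_stream.
  by exists (exist _ T cfT) => X; exact: termT.
- move=> A B; exists (flowing_prod A B), (flowing_fst A B), (flowing_snd A B).
  exact: flowing_prod_product.
- move=> A B; exists (flowing_exp A B), (flowing_prod (flowing_exp A B) A).
  exists (flowing_fst _ _), (flowing_snd _ _), (flowing_eval A B).
  split; [exact: flowing_prod_product|exact: flowing_exp_exponential].
Qed.
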